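(* Let $A\in\mathbb{R}^{n\times n}$ be the adjacency matrix of a directed, unweighted network on $n$ nodes with at least one edge ($a_{ij}=1$ if there is an edge from $i$ to $j$, $0$ otherwise), with spectral radius $\rho(A)$ (where $1/\rho(A)$ is read as $+\infty$ if $\rho(A)=0$). Let $\mathbf{1}$ be the all-ones vector and $\mathbf{d}^{\mathrm{out}}=A\mathbf{1}$. For $0<\alpha<1/\rho(A)$ let $\mathbf{x}(\alpha)=\left(I+\alpha A+\alpha^2A^2+\cdots\right)\mathbf{1}$. Then: (a) there exists $\alpha^\star>0$ such that for all $0<\alpha<\alpha^\star$ (with $\alpha<1/\rho(A)$), \[ \frac{(\mathbf{d}^{\mathrm{out}})^T\mathbf{x}(\alpha)}{\|\mathbf{d}^{\mathrm{out}}\|_1}-\frac{\|\mathbf{x}(\alpha)\|_1}{n}\ \ge\ 0, \] with equality if and only if all nodes have the same out-degree; (b) if \[ \mathbf{1}^TA^TA^{k}\mathbf{1}\ \ge\ \mathbf{1}^TA^{k}\mathbf{1}\,\frac{\mathbf{1}^TA\mathbf{1}}{n} \] holds for every $k\ge1$, then the inequality in (a) holds for all $0<\alpha<1/\rho(A)$.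
   Context: $\|\mathbf{v}\|_1=\sum_i|v_i|$. $\mathbf{x}(\alpha)$ is the (broadcast) Katz centrality vector. *)

(* Defs.v *)
From HB Require Import structures.
From mathcomp Require Export all_boot all_order all_algebra.
From mathcomp Require Export all_classical all_reals all_analysis.
From mathcomp Require Export complex.

Set Implicit Arguments.
Unset Strict Implicit.
Unset Printing Implicit Defensive.

Import Order.TTheory GRing.Theory Num.Theory.
Import numFieldNormedType.Exports.

Local Open Scope classical_set_scope.
Local Open Scope ring_scope.

Section Defs.
Context {R : realType} {n : nat}.

(* A directed unweighted network on n nodes is an arbitrary relation e on
   'I_n; e i j means that there is an edge from i to j. *)
Definition adjacency (e : rel 'I_n) : 'M[R]_n := \matrix_(i, j) (e i j)%:R.

Definition ones : 'cV[R]_n := const_mx 1.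

Definition out_degree (A : 'M[R]_n) : 'cV[R]_n := A *m ones.

Definition norm1 (v : 'cV[R]_n) : R := \sum_i `|v i 0|.

(* The eigenvalues are those of A viewed as a matrix over R[i];
   Normc.normc is the R-valued modulus. *)
Definition spectral_radius (A : 'M[R]_n) : R :=
  sup [set Normc.normc z | z in
        [set z : R[i] | eigenvalue (map_mx (real_complex R) A) z]].

(* The series is taken in the topology of 'M[R]_n; lim has an unspecified
   value where the series diverges, so katz is meaningful only where it
   converges, in particular for 0 < alpha < 1 / spectral_radius A. *)
Definition katz (A : 'M[R]_n) (alpha : R) : 'cV[R]_n :=
  lim (series (fun k => alpha ^+ k *: A ^+ k) @ \oo) *m ones.

(* The inverse is that of \bar R, for which 0^-1 = +oo. *)
Definition katz_admissible (A : 'M[R]_n) (alpha : R) : Prop :=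
  0 < alpha /\ (alpha%:E < ((spectral_radius A)%:E)^-1)%E.

Definition katz_gap (A : 'M[R]_n) (alpha : R) : R :=
  ((out_degree A)^T *m katz A alpha) 0 0 / norm1 (out_degree A)
  - norm1 (katz A alpha) / n%:R.

End Defs.

(* Main.v *)
(** Write [d] for the out-degrees, [m] for their mean and [L v] for the linear
    form [\sum_i (d i - m) * v i].  Since [katz] is nonnegative, the gap is a
    positive multiple of [L x], where [x] is the Katz vector.

    For (b), [L 1 = 0], and the hypothesis says that [L (A^k 1) >= 0] for
    [k >= 1], so [L] is nonnegative on the partial sums of the series.  For (a),
    [x = 1 + alpha A x] iterated twice gives
    [L x = alpha * (L d + alpha * L (A^2 x))], where [L d = \sum_i (d i - m)^2]
    vanishes exactly when the out-degrees agree, and [L (A^2 x)] stays bounded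
    for [alpha <= 1 / (2 n)].

    The series converges for [alpha < 1 / rho(A)] because the entries of [A^k]
    are [O(q^k)] for every [q > rho(A)]: over [R[i]], [A] is similar to a
    triangular matrix, whose norm for suitable geometric weights is at most
    [q]. *)

Require Import Defs.
From mathcomp Require Import spectral.
From mathcomp Require Import ring lra.
Set Implicit Arguments.
Unset Strict Implicit.
Unset Printing Implicit Defensive.
Import Order.TTheory GRing.Theory Num.Theory.
Import numFieldNormedType.Exports.
Local Open Scope classical_set_scope.
Local Open Scope ring_scope.

(** * Growth of matrix powers from a bound on the eigenvalues *)

(** This controls the absolute row sums of [T] conjugated by the diagonal matrix of the [M ^+ j],
    hence an operator norm of [T], which passes to powers as a bound on single entries would not. *)
Lemma trigmx_weighted_row_sum (C : numFieldType) (n : nat) (T : 'M[C]_n)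
    (r q : C) : is_trig_mx T -> r < q -> (forall i, `|T i i| <= r) ->
  exists2 M : C, 1 <= M &
    forall i : 'I_n, \sum_j `|T i j| * M ^+ j <= q * M ^+ i.
Proof.
move=> /is_trig_mxP Ttrig rq Tr.
(* Below the diagonal [M ^+ j <= M ^+ i / M], so a large [M] makes the strictly
   lower part of row [i] cost at most [(q - r) * M ^+ i]. *)
pose b := \sum_i \sum_j `|T i j|.
have b0 : 0 <= b by do 2!apply: sumr_ge0 => ? _.
have qr : 0 < q - r by rewrite subr_gt0.
pose M := 1 + b / (q - r).
have M1 : 1 <= M by rewrite lerDl divr_ge0 // ltW.
have M0 : 0 < M by apply: lt_le_trans M1.
exists M => // i; rewrite (bigD1 i) //=.
have -> : q * M ^+ i = r * M ^+ i + (q - r) * M ^+ i by rewrite -mulrDl subrKC.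
apply: lerD; first by rewrite ler_wpM2r // exprn_ge0 // ltW.
rewrite -(ler_pM2r M0) mulr_suml.
have le_b : \sum_(j | j != i) `|T i j| <= b.
  apply: (@le_trans _ _ (\sum_j `|T i j|)).
    by rewrite [leRHS](bigD1 i) //= lerDr.
  by rewrite /b [leRHS](bigD1 i) //= lerDl; do 2!apply: sumr_ge0 => ? _.
apply: (@le_trans _ _ (b * M ^+ i)); last first.
  rewrite mulrAC ler_wpM2r ?exprn_ge0 ?(ltW M0) //.
  rewrite /M mulrDr mulr1 mulrCA divff ?gt_eqF // mulr1 lerDr; exact: ltW.
apply: le_trans (ler_wpM2r (exprn_ge0 _ (ltW M0)) le_b).
rewrite mulr_suml; apply: ler_sum => j ji.
case: (ltngtP i j) => [ij|ij|/val_inj ij]; last by rewrite ij eqxx in ji.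
  by rewrite Ttrig // normr0 !mul0r.
by rewrite -mulrA -exprSr ler_wpM2l // ler_weXn2l.
Qed.

(** The weighted row-sum bound is multiplicative, so [T ^+ k] satisfies it with [q ^+ k]. The
    weights lie between [1] and [M ^+ n], so removing them costs the factor [K = M ^+ n]. *)
Lemma trigmx_expr_bound (C : numFieldType) (n : nat) (T : 'M[C]_n)
    (r q : C) : is_trig_mx T -> 0 <= q -> r < q -> (forall i, `|T i i| <= r) ->
  exists2 K : C, 0 <= K & forall k i j, `|(T ^+ k) i j| <= K * q ^+ k.
Proof.
move=> Ttrig q0 rq Tr.
have [M M1 HM] := trigmx_weighted_row_sum Ttrig rq Tr.
have M0 : 0 <= M by apply: le_trans M1.
have step k (i : 'I_n) : \sum_j `|(T ^+ k) i j| * M ^+ j <= q ^+ k * M ^+ i.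
  elim: k i => [|k IH] i.
    rewrite expr0 mul1r (bigD1 i) //= big1 => [|j ji].
      by rewrite mxE eqxx normr1 mul1r addr0.
    by rewrite mxE eq_sym (negPf ji) normr0 mul0r.
  rewrite [q ^+ _]exprS -mulrA.
  apply: (@le_trans _ _ (\sum_l `|(T ^+ k) i l| * (q * M ^+ l))); last first.
    under eq_bigr do rewrite mulrCA.
    by rewrite -mulr_sumr ler_wpM2l.
  apply: (@le_trans _ _
      (\sum_l `|(T ^+ k) i l| * \sum_j `|T l j| * M ^+ j)); last first.
    by apply: ler_sum => l _; rewrite ler_wpM2l.
  under [leRHS]eq_bigr do rewrite mulr_sumr.
  rewrite exchange_big /=; apply: ler_sum => j _.
  rewrite exprSr mxE.
  under eq_bigr do rewrite mulrA -normrM.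
  by rewrite -mulr_suml ler_wpM2r ?exprn_ge0 // ler_norm_sum.
exists (M ^+ n) => [|k i j]; first exact: exprn_ge0.
rewrite mulrC; apply: (@le_trans _ _ (q ^+ k * M ^+ i)); last first.
  by rewrite ler_wpM2l ?exprn_ge0 // ler_weXn2l // ltnW.
apply: le_trans (step k i); rewrite (bigD1 j) //=.
apply: (@le_trans _ _ (`|(T ^+ k) i j| * M ^+ j)).
  by rewrite ler_peMr // exprn_ege1.
by rewrite lerDl sumr_ge0 // => l _; rewrite mulr_ge0 ?exprn_ge0.
Qed.

Lemma expr_bound_of_eigenvalues (C : numClosedFieldType) (n : nat)
    (A : 'M[C]_n) (r q : C) :
    0 <= q -> r < q -> (forall z, eigenvalue A z -> `|z| <= r) ->
  forall i j, exists K : C, forall k, `|(A ^+ k) i j| <= K * q ^+ k.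
Proof.
move=> q0 rq Ar i j.
have n0 : (0 < n)%N by case: n A Ar i j => [? ? []|].
have [P /unitarymx_unit Pu] := Schur A n0.
rewrite /similar_to /= conjumx //; set T := (P *m A *m invmx P) => Ttrig.
(* The diagonal entries of the triangular [T] are roots of its characteristic polynomial, and
   eigenvalues of [T] are eigenvalues of the similar matrix [A]. *)
have Teig l : eigenvalue A (T l l).
  have PA : (P *m A <= P)%MS by rewrite submx_full // row_full_unit.
  apply: (eigenvalue_conjmx PA); first by rewrite row_free_unit.
  rewrite conjumx // -/T -topredE /= eigenvalue_root_char char_poly_trig //.
  by rewrite rootE horner_prod (bigD1 l) //= !hornerE subrr mul0r.
have [K K0 HK] := trigmx_expr_bound Ttrig q0 rq (fun l => Ar _ (Teig l)).
have AE k : A ^+ k = invmx P *m T ^+ k *m P.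
  elim: k => [|k IH]; first by rewrite !expr0 mulmx1 mulVmx.
  by rewrite !exprS IH -!mulmxE /T !mulmxA mulVmx // mul1mx.
exists (K * \sum_m (\sum_l `|invmx P i l|) * `|P m j|) => k.
rewrite AE mxE mulrAC mulr_sumr; apply: le_trans (ler_norm_sum _ _ _) _.
apply: ler_sum => m _; rewrite normrM mulrA ler_wpM2r // mxE mulr_sumr.
apply: le_trans (ler_norm_sum _ _ _) _; apply: ler_sum => l _.
by rewrite normrM mulrC ler_wpM2r.
Qed.

(** * The spectral radius of a real matrix *)

Section SpectralRadius.
Variables (R : realType) (n : nat) (A : 'M[R]_n).
Let AC := map_mx (real_complex R) A.

(** A [sup] dominates its set only when the set is bounded above; here the sum of the moduli of all
    roots of the characteristic polynomial is an upper bound. *)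
Lemma normc_le_spectral_radius (z : R[i]) :
  eigenvalue AC z -> Normc.normc z <= spectral_radius A.
Proof.
move=> zA; apply: ub_le_sup; last by exists z.
have [s sE] := closed_field_poly_normal (char_poly AC).
exists (\sum_(y <- s) Normc.normc y) => _ [y yA <-].
have ys : y \in s.
  move: yA; rewrite /= eigenvalue_root_char sE (monicP (char_poly_monic _)) scale1r.
  by rewrite root_prod_XsubC.
rewrite (big_rem y) //= lerDl sumr_ge0 // => x _.
by case: x => a b; rewrite /Normc.normc sqrtr_ge0.
Qed.

Lemma spectral_radius_ge0 : 0 <= spectral_radius A.
Proof.
case: (pselect (exists z, eigenvalue AC z)) => [[z zA]|noz].
  apply: le_trans (normc_le_spectral_radius zA).
  by case: z {zA} => a b; rewrite /Normc.normc sqrtr_ge0.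
(* Without eigenvalues, as for [n = 0], the [sup] is that of the empty set, which is [0] by
   convention. *)
rewrite /spectral_radius.
rewrite (_ : [set z | _] = set0) ?image_set0 ?sup0 //.
by apply/seteqP; split => z //= zA; apply: noz; exists z.
Qed.

Lemma expr_bound_of_spectral_radius (q : R) : spectral_radius A < q ->
  forall i j, exists K : R, forall k, `|(A ^+ k) i j| <= K * q ^+ k.
Proof.
move=> rq i j.
have q0 : 0 <= q by apply: le_trans (ltW rq); exact: spectral_radius_ge0.
have [||z zA|K HK] := @expr_bound_of_eigenvalues R[i] n AC
    (spectral_radius A)%:C%C q%:C%C _ _ _ i j.
- by rewrite ler0c.
- by rewrite ltcR.
- by change ((Normc.normc z)%:C%C <= (spectral_radius A)%:C%C);
     rewrite lecR normc_le_spectral_radius.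
(* [K] is only known to lie in [R[i]]. Its modulus serves instead, because [K * q ^+ k] dominates a
   modulus and is therefore a nonnegative real. *)
exists (Normc.normc K) => k; rewrite -lecR rmorphM rmorphXn /=.
change (`|(A ^+ k) i j|%:C%C <= `|K| * q%:C%C ^+ k).
have /ger0_norm <- : 0 <= q%:C%C ^+ k by rewrite exprn_ge0 // ler0c.
rewrite -normrM; apply: le_trans (real_ler_norm _); last first.
  rewrite -[K * _]subr0; apply: ger0_real; rewrite subr0.
  exact: le_trans (HK k).
apply: le_trans (HK k).
have -> : AC ^+ k = map_mx (real_complex R) (A ^+ k).
  elim: k => [|k IH]; first by rewrite !expr0 map_mx1.
  by rewrite !exprS IH -!mulmxE map_mxM.
rewrite mxE normc_def /= expr0n addr0 lecR sqrtr_sqr //.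
Qed.

End SpectralRadius.

(** * Convergence of the Katz series, fixed-point equation and positivity *)

Lemma cvg_mx_coord (R : realType) (m n : nat) (u : nat -> 'M[R]_(m, n))
    (L : 'M[R]_(m, n)) :
  (forall i j, (fun N => u N i j) @ \oo --> L i j) -> u @ \oo --> L.
Proof.
move=> uL; apply/cvg_mx_entourageP => E entE.
have uLE i j : \forall N \near \oo, (L i j, u N i j) \in E.
  have /cvg_app_entourageP/(_ E entE) := uL i j.
  by apply: filterS => N; rewrite inE.
rewrite near_map; apply: filter_forall => i; apply: filter_forall => j.
exact: uLE.
Qed.

Section Katz.
Variables (R : realType) (n : nat) (A : 'M[R]_n) (alpha : R).
Hypothesis adm : katz_admissible A alpha.

Let S (N : nat) (i : 'I_n) : R :=
  \sum_(0 <= k < N) alpha ^+ k * (A ^+ k *m ones) i 0.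

Lemma is_cvg_katz_series :
  cvg (series (fun k => alpha ^+ k *: A ^+ k) @ \oo).
Proof.
(* Inverting in [\bar R] yields [spectral_radius A < alpha^-1], including when the spectral radius
   is [0]. *)
case: adm => a0; rewrite inve_pgt ?inE ?lee_fin ?spectral_radius_ge0 ?ltW //.
rewrite inver (gt_eqF a0) lte_fin => ra.
(* Any [q] strictly between the spectral radius and [alpha^-1] gives domination by a geometric
   series of ratio [alpha * q < 1]; the midpoint is one. *)
pose q := (spectral_radius A + alpha^-1) / 2.
have rq : spectral_radius A < q by rewrite /q; lra.
have q0 : 0 <= q by apply: le_trans (ltW rq); exact: spectral_radius_ge0.
have aq : `|alpha * q| < 1.
  have aq0 : 0 <= alpha * q by rewrite mulr_ge0 // ltW.
  rewrite (ger0_norm aq0) -ltr_pdivlMl // mulr1.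
  by rewrite /q; lra.
have entry i j : cvgn (series (fun k => alpha ^+ k * (A ^+ k) i j)).
  have [K HK] := expr_bound_of_spectral_radius rq i j.
  apply: normed_cvg.
  apply: (@series_le_cvg _ _ (geometric K (alpha * q))) => [k|k|k|].
  - by rewrite /= normr_ge0.
  - rewrite /= exprMn mulrCA mulr_ge0 ?exprn_ge0 ?(ltW a0) //.
    exact: le_trans (HK k).
  - rewrite /= normrM exprMn mulrCA [`|alpha ^+ k|]ger0_norm ?exprn_ge0 ?(ltW a0) //.
    by rewrite ler_wpM2l ?exprn_ge0 ?(ltW a0).
  - exact: is_cvg_geometric_series.
apply/cvg_ex.
exists (\matrix_(i, j) lim (series (fun k => alpha ^+ k * (A ^+ k) i j) @ \oo)).
apply: cvg_mx_coord => i j; rewrite mxE.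
rewrite (_ : (fun N => _) = series (fun k => alpha ^+ k * (A ^+ k) i j)).
  exact: entry.
by apply/funext => N; rewrite /series /= summxE; apply: eq_bigr => k _; rewrite mxE.
Qed.

Lemma cvg_katz i : S ^~ i @ \oo --> katz A alpha i 0.
Proof.
rewrite /katz mxE.
rewrite (_ : S ^~ i = fun N => \sum_j
    series (fun k => alpha ^+ k *: A ^+ k) N i j * (ones : 'cV[R]_n) j 0).
  apply: (cvg_big add_continuous) => j _; apply: cvgM; last exact: cvg_cst.
  have h := @coord_continuous R n n i j.
  exact: (cvg_comp _ _ is_cvg_katz_series (h _)).
apply/funext => N; rewrite /S /series /=.
under [RHS]eq_bigr do rewrite summxE mulr_suml.
rewrite exchange_big /=; apply: eq_bigr => k _.
rewrite mxE mulr_sumr; apply: eq_bigr => j _.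
by rewrite !mxE mulrA.
Qed.

Lemma cvg_katz_lin (c : 'I_n -> R) :
  (fun N => \sum_i c i * S N i) @ \oo --> \sum_i c i * katz A alpha i 0.
Proof.
apply: (cvg_big add_continuous) => i _; apply: cvgM; [exact: cvg_cst|exact: cvg_katz].
Qed.

(** The partial sums satisfy the recurrence [S N.+1 = 1 + alpha A (S N)], and the equation is its
    limit. *)
Lemma katz_fixpoint i :
  katz A alpha i 0 = 1 + alpha * \sum_j A i j * katz A alpha j 0.
Proof.
have h1 : S N.+1 i @[N --> \oo] --> katz A alpha i 0.
  by rewrite (cvg_shiftS (S ^~ i)); exact: cvg_katz.
suff h2 : S N.+1 i @[N --> \oo] --> 1 + alpha * \sum_j A i j * katz A alpha j 0.
  exact: (cvg_unique _ h1 h2).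
rewrite (_ : (fun N => S N.+1 i) =
    fun N => 1 + alpha * \sum_j A i j * S N j).
  apply: cvgD; first exact: cvg_cst.
  by apply: cvgM; [exact: cvg_cst|exact: cvg_katz_lin].
apply/funext => N; rewrite /S big_nat_recl //=; congr (_ + _).
  by rewrite !expr0 mul1mx mul1r mxE.
under [in RHS]eq_bigr do rewrite mulr_sumr.
rewrite exchange_big /= mulr_sumr; apply: eq_bigr => k _.
rewrite !exprS -mulmxE -mulmxA mxE -mulrA; congr (_ * _).
by rewrite mulr_sumr; apply: eq_bigr => j _; rewrite mulrCA.
Qed.

(** On each partial sum the form is a combination of its values on the [A ^+ k *m ones] with
    coefficients [alpha ^+ k >= 0]; the sign survives the limit. *)
Lemma katz_lin_ge0 (c : 'I_n -> R) :
    (forall k, 0 <= \sum_i c i * (A ^+ k *m ones) i 0) ->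
  0 <= \sum_i c i * katz A alpha i 0.
Proof.
move=> c0; apply: (cvgr_to_ge (cvg_katz_lin (c := c))).
apply: nearW => N.
under eq_bigr do rewrite mulr_sumr.
rewrite exchange_big /=; apply: sumr_ge0 => k _.
under eq_bigr do rewrite mulrCA.
by rewrite -mulr_sumr mulr_ge0 ?exprn_ge0 //; case: adm => /ltW.
Qed.

Hypothesis A_ge0 : forall i j, 0 <= A i j.

Lemma katz_ge0 i : 0 <= katz A alpha i 0.
Proof.
have -> : katz A alpha i 0 = \sum_j (j == i)%:R * katz A alpha j 0.
  rewrite (bigD1 i) //= eqxx mul1r big1 ?addr0 // => j /negPf ->.
  by rewrite mul0r.
apply: katz_lin_ge0 => k; apply: sumr_ge0 => j _; rewrite mulr_ge0 //.
elim: k j => [|k IH] j; first by rewrite expr0 mul1mx mxE.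
by rewrite exprS -mulmxE -mulmxA mxE sumr_ge0 // => l _; rewrite mulr_ge0.
Qed.

End Katz.

(** * The gap as a linear form in the Katz vector, and its expansion in [alpha] *)

Section Gap.
Variables (R : realType) (n : nat) (A : 'M[R]_n).
Hypothesis A_ge0 : forall i j, 0 <= A i j.

Let d i := out_degree A i 0.
Let mean_degree := (\sum_i d i) / n%:R.
(** The coefficients of the linear form [L]. *)
Let c i := d i - mean_degree.

Lemma out_degreeE i : out_degree A i 0 = \sum_j A i j.
Proof. by rewrite mxE; apply: eq_bigr => j _; rewrite mxE mulr1. Qed.

Let d_ge0 i : 0 <= d i.
Proof. by rewrite /d out_degreeE sumr_ge0. Qed.

Lemma norm1_ge0E (v : 'cV[R]_n) :
  (forall i, 0 <= v i 0) -> norm1 v = \sum_i v i 0.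
Proof. by move=> v0; apply: eq_bigr => i _; rewrite ger0_norm. Qed.

(** Nonnegativity of the degrees and centralities turns both norms into plain sums. *)
Lemma katz_gapE (alpha : R) : katz_admissible A alpha -> 0 < \sum_i d i ->
  katz_gap A alpha = (\sum_i c i * katz A alpha i 0) / \sum_i d i.
Proof.
move=> adm S0; rewrite /katz_gap !norm1_ge0E // => [|i]; last exact: katz_ge0.
rewrite mxE; under eq_bigr do rewrite mxE -/(d _).
rewrite [in RHS](eq_bigr _ (fun i _ => mulrBl _ _ _)) sumrB -mulr_sumr mulrBl.
congr (_ - _); rewrite /mean_degree [RHS]mulrC !mulrA mulVf ?gt_eqF //.
by rewrite mul1r mulrC.
Qed.

Lemma centered_degree_sum0 : (0 < n)%N -> \sum_i c i = 0.
Proof.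
move=> n0; rewrite sumrB sumr_const card_ord /mean_degree -[X in _ - X]mulr_natr.
by rewrite divfK ?subrr // pnatr_eq0 -lt0n.
Qed.

(** The two sides differ by [mean_degree * \sum_i c i], which is zero. *)
Lemma degree_covariance : (0 < n)%N -> \sum_i c i * d i = \sum_i c i ^+ 2.
Proof.
move=> n0; apply/eqP; rewrite -subr_eq0 -sumrB.
under eq_bigr do rewrite expr2 -mulrBr /c subKr.
by rewrite -mulr_suml centered_degree_sum0 // mul0r.
Qed.

Lemma degree_variance_gt0 : (0 < n)%N ->
  ~ (forall i j, d i = d j) -> 0 < \sum_i c i ^+ 2.
Proof.
move=> n0 irr; rewrite lt_def sumr_ge0 => [|i _]; last exact: sqr_ge0.
rewrite andbT; apply/eqP => /eqP; rewrite psumr_eq0 => [/allP c0|i _]; last first.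
  exact: sqr_ge0.
apply: irr => i j; have dm k : d k = mean_degree.
  have := c0 k (mem_index_enum _); rewrite /= sqrf_eq0 subr_eq0.
  by move/eqP.
by rewrite !dm.
Qed.

Lemma centered_degree_regular : (0 < n)%N ->
  (forall i j, d i = d j) -> forall i, c i = 0.
Proof.
move=> n0 reg i; rewrite /c /mean_degree (eq_bigr (fun=> d i)) => [|j _ //].
by rewrite sumr_const card_ord -(mulr_natr (d i)) mulfK ?subrr // pnatr_eq0 -lt0n.
Qed.

Hypothesis A_le1 : forall i j, A i j <= 1.

Let sum_le (F : 'I_n -> R) (b : R) : (forall i, F i <= b) -> \sum_i F i <= n%:R * b.
Proof.
move=> Fb; apply: (@le_trans _ _ (\sum_(i < n) b)); first exact: ler_sum.
by rewrite sumr_const card_ord mulr_natl.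
Qed.

Lemma centered_degree_bound i : (0 < n)%N -> `|c i| <= n%:R.
Proof.
move=> n0; have nR : 0 < n%:R :> R by rewrite ltr0n.
have dn j : d j <= n%:R.
  by rewrite /d out_degreeE -[leRHS]mulr1; exact: sum_le.
have m0 : 0 <= mean_degree by rewrite divr_ge0 ?sumr_ge0.
have mn : mean_degree <= n%:R by rewrite ler_pdivrMr //; exact: sum_le.
rewrite ler_norml /c; have := d_ge0 i; have := dn i; lra.
Qed.

(** Summing the fixed-point equation gives [X <= n + alpha * n * X] for the sum [X], and
    [alpha * n <= 1 / 2] absorbs the last term. *)
Lemma katz_sum_bound (alpha : R) : katz_admissible A alpha ->
  alpha * (2 * n%:R) <= 1 -> \sum_i katz A alpha i 0 <= 2 * n%:R.
Proof.
move=> adm an; set X := \sum_i _.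
have a0 : 0 <= alpha by case: adm => /ltW.
have X0 : 0 <= X by apply: sumr_ge0 => i _; exact: katz_ge0.
have : X <= n%:R * (1 + alpha * X).
  apply: sum_le => i; rewrite katz_fixpoint // lerD2l ler_wpM2l //.
  by apply: ler_sum => j _; rewrite ler_piMl ?katz_ge0.
have := ler_wpM2r X0 an; nra.
Qed.

(** The innermost sum is at most [2 n]; the sum over [j], the coefficient [c i] and the sum over [i]
    contribute a factor [n] each. *)
Lemma katz_second_order_bound (alpha : R) : (0 < n)%N ->
    katz_admissible A alpha -> alpha * (2 * n%:R) <= 1 ->
  `|\sum_i c i * \sum_j A i j * \sum_l A j l * katz A alpha l 0|
    <= 2 * n%:R ^+ 4.
Proof.
move=> n0 adm an.
have n0R : 0 <= n%:R :> R by [].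
have in0 j : 0 <= \sum_l A j l * katz A alpha l 0.
  by apply: sumr_ge0 => l _; rewrite mulr_ge0 // katz_ge0.
have in1 j : \sum_l A j l * katz A alpha l 0 <= 2 * n%:R.
  apply: le_trans (katz_sum_bound adm an).
  by apply: ler_sum => l _; rewrite ler_piMl ?katz_ge0.
rewrite (_ : 2 * _ = n%:R * (n%:R * (n%:R * (2 * n%:R)))); last by ring.
apply: le_trans (ler_norm_sum _ _ _) _; apply: sum_le => i.
rewrite normrM ler_pM ?centered_degree_bound //.
rewrite ger0_norm; last by apply: sumr_ge0 => j _; rewrite mulr_ge0.
apply: sum_le => j; apply: le_trans (in1 j).
by rewrite ler_piMl.
Qed.

Lemma katz_expansion (alpha : R) : (0 < n)%N -> katz_admissible A alpha ->
  \sum_i c i * katz A alpha i 0 =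
  alpha * (\sum_i c i ^+ 2
    + alpha * \sum_i c i * \sum_j A i j * \sum_l A j l * katz A alpha l 0).
Proof.
move=> n0 adm; set x := katz A alpha.
have xE i : c i * x i 0 = c i + (alpha * (c i * d i) +
    alpha * (alpha * (c i * \sum_j A i j * \sum_l A j l * x l 0))).
  rewrite {1}/x katz_fixpoint // /d out_degreeE.
  have -> : \sum_j A i j * katz A alpha j 0 =
      \sum_j A i j + alpha * \sum_j A i j * \sum_l A j l * x l 0.
    rewrite mulr_sumr -big_split /=; apply: eq_bigr => j _.
    by rewrite katz_fixpoint // -/x; ring.
  by ring.
under eq_bigr do rewrite xE.
rewrite big_split /= centered_degree_sum0 // add0r big_split /= -!mulr_sumr.
by rewrite degree_covariance // mulrDr.
Qed.

End Gap.

Theorem theorem7 (R : realType) (n : nat) (e : rel 'I_n)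
    (edge : exists i j : 'I_n, e i j) :
  let A : 'M[R]_n := adjacency e in
  let u : 'cV[R]_n := ones in
  (exists alphastar : R, 0 < alphastar /\
     forall alpha : R, katz_admissible A alpha -> alpha < alphastar ->
       0 <= katz_gap A alpha /\
       (katz_gap A alpha = 0 <->
          forall i j : 'I_n, out_degree A i 0 = out_degree A j 0))
  /\
  ((forall k : nat, (1 <= k)%N ->
      (u^T *m A^T *m A ^+ k *m u) 0 0
        >= (u^T *m A ^+ k *m u) 0 0 * ((u^T *m A *m u) 0 0 / n%:R)) ->
   forall alpha : R, katz_admissible A alpha -> 0 <= katz_gap A alpha).
Proof.
move=> A u; have [i0 [j0 e0]] := edge.
have n0 : (0 < n)%N by case: n i0 {A u edge j0 e0 e} => [[]|].
have nR : 0 < n%:R :> R by rewrite ltr0n.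
have A0 i j : 0 <= A i j by rewrite mxE.
have A1 i j : A i j <= 1 by rewrite mxE; case: (e i j); rewrite ?ler01.
have d0 i : 0 <= out_degree A i 0 by rewrite out_degreeE sumr_ge0.
have S0 : 0 < \sum_i out_degree A i 0.
  rewrite (bigD1 i0) //= ltr_pwDl ?sumr_ge0 // out_degreeE (bigD1 j0) //=.
  by rewrite ltr_pwDl ?sumr_ge0 // mxE e0.
split.
- case: (pselect (forall i j, out_degree A i 0 = out_degree A j 0)) => reg.
    (* With equal out-degrees every [c i] vanishes, so the gap is identically zero and any threshold
       works. *)
    exists 1; split=> // alpha adm _.
    suff -> : katz_gap A alpha = 0 by [].
    rewrite katz_gapE // big1 ?mul0r // => i _.
    by rewrite (centered_degree_regular n0 reg) mul0r.
  have := degree_variance_gt0 n0 reg; set V := \sum_i _ => V0.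
  have n4 : 0 < 2 * n%:R ^+ 4 :> R by rewrite mulr_gt0 ?exprn_gt0.
  (* The first bound makes [katz_second_order_bound] applicable; the second gives
     [alpha * (2 * n%:R ^+ 4) < V], so the variance outweighs the remainder. *)
  exists (Num.min (2 * n%:R)^-1 (V / (2 * n%:R ^+ 4))); split.
    by rewrite lt_min invr_gt0 divr_gt0 // mulr_gt0.
  move=> alpha adm; rewrite lt_min => /andP[a1 a2].
  have a0 : 0 < alpha by case: adm.
  (* With unequal out-degrees both sides of the equivalence are false once the gap is strictly
     positive. *)
  suff gap : 0 < katz_gap A alpha.
    by split; [exact: ltW|split=> // g0; rewrite g0 ltxx in gap].
  rewrite katz_gapE // divr_gt0 // katz_expansion // mulr_gt0 // -/V.
  have an : alpha * (2 * n%:R) <= 1.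
    by rewrite -ler_pdivlMr ?mulr_gt0 // mul1r ltW.
  have := katz_second_order_bound A0 A1 n0 adm an.
  set Q := \sum_i _; rewrite ler_norml => /andP[Q1 _].
  move: a2; rewrite ltr_pdivlMr // => a2.
  have := ler_wpM2l (ltW a0) Q1; lra.
- move=> H alpha adm; rewrite katz_gapE // divr_ge0 ?(ltW S0) //.
  have dotE (v w : 'cV[R]_n) : (v^T *m w) 0 0 = \sum_i v i 0 * w i 0.
    by rewrite mxE; apply: eq_bigr => i _; rewrite mxE.
  (* The hypothesis says nothing about [k = 0]; there the form vanishes because the [c i] sum to
     zero. *)
  apply: katz_lin_ge0 => // -[|k].
    rewrite expr0 mul1mx; under eq_bigr do rewrite [ones _ _]mxE mulr1.
    by rewrite centered_degree_sum0.
  have := H k.+1 isT.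
  (* Regrouping [u^T *m A^T] as the transpose of [A *m u] makes the out-degrees appear. *)
  rewrite -trmx_mul -!mulmxA !dotE.
  under [X in X * _ <= _]eq_bigr do rewrite mxE mul1r.
  under [X in _ * (X / _) <= _]eq_bigr do rewrite mxE mul1r.
  rewrite -/(out_degree A) => h.
  under eq_bigr do rewrite mulrBl.
  by rewrite sumrB -mulr_sumr subr_ge0 mulrC.
Qed.
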